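(* Let $X$ be a path-connected, compact, metrizable topological space, $x_0\in X$, $n\geq 1$. Then the homeomorphism type of $\pi_n(X,x_0)$ with the topology induced by the pseudometric $\rho$ is independent of the choice of metric $d$ inducing the topology of $X$.
   Context: For a metric $d$ on $X$: $\Omega^n(X,x_0)$ is the set of continuous maps $\alpha:[0,1]^n\to X$ with $\alpha(\partial[0,1]^n)=\{x_0\}$, with uniform metric $\mu(\alpha,\beta)=\sup_t d(\alpha(t),\beta(t))$, and $\rho(a,b)=\inf\{\mu(\alpha,\beta)\mid\alpha\in a,\beta\in b\}$ for $a,b\in\pi_n(X,x_0)$, a pseudometric; its topology is generated by open $\rho$-balls. *)

(* Defs.v *)
From HB Require Import structures.
From mathcomp Require Import all_boot all_order all_algebra.
From mathcomp Require Import all_classical all_reals all_analysis.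
Import Order.TTheory GRing.Theory Num.Theory.
Import numFieldNormedType.Exports.
Local Open Scope classical_set_scope.
Local Open Scope ring_scope.

Section HomotopyGroups.
Variables (R : realType) (T : topologicalType).

Definition is_metric (d : T -> T -> R) : Prop :=
  [/\ forall x y, 0 <= d x y,
      forall x y, d x y = 0 <-> x = y,
      forall x y, d x y = d y x &
      forall x y z, d x z <= d x y + d y z].

Definition induces_topology (d : T -> T -> R) : Prop :=
  forall A : set T, open A <->
    (forall x, A x -> exists2 e : R, 0 < e & [set y | d x y < e] `<=` A).

Definition metric_of_T (d : T -> T -> R) : Prop :=
  is_metric d /\ induces_topology d.

Definition path_connected : Prop :=
  forall x y : T, exists g : R -> T,
    [/\ {within `[0, 1], continuous g}, g 0 = x & g 1 = y].

Definition cube (n : nat) : set 'rV[R]_n :=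
  [set t | forall i, 0 <= t ord0 i <= 1].

Definition cube_boundary (n : nat) : set 'rV[R]_n :=
  [set t | cube n t /\ exists i, t ord0 i = 0 \/ t ord0 i = 1].

Definition Omega (n : nat) (x0 : T) : set ('rV[R]_n -> T) :=
  [set a | {within cube n, continuous a} /\
           forall t, cube_boundary n t -> a t = x0].

Definition homotopic_rel (n : nat) (x0 : T) (a b : 'rV[R]_n -> T) : Prop :=
  exists H : R * 'rV[R]_n -> T,
    [/\ {within `[0, 1] `*` cube n, continuous H},
        forall t, cube n t -> H (0, t) = a t,
        forall t, cube n t -> H (1, t) = b t &
        forall s t, 0 <= s <= 1 -> cube_boundary n t -> H (s, t) = x0].

Definition is_pi_class (n : nat) (x0 : T) (A : set ('rV[R]_n -> T)) : Prop :=
  exists2 a, Omega n x0 a & A = [set b | Omega n x0 b /\ homotopic_rel n x0 a b].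

Definition pi_n (n : nat) (x0 : T) : Type :=
  {A : set ('rV[R]_n -> T) | is_pi_class n x0 A}.

Definition mu (d : T -> T -> R) (n : nat) (a b : 'rV[R]_n -> T) : R :=
  sup [set d (a t) (b t) | t in cube n].

Definition rho (d : T -> T -> R) (n : nat) (x0 : T) (a b : pi_n n x0) : R :=
  inf [set mu d n al be | al in [set al | sval a al] & be in [set be | sval b be]].

Definition rho_open (d : T -> T -> R) (n : nat) (x0 : T) (U : set (pi_n n x0)) : Prop :=
  forall a, U a -> exists (c : pi_n n x0) (r : R),
      rho d n x0 c a < r /\ [set b | rho d n x0 c b < r] `<=` U.

End HomotopyGroups.

(* Main.v *)
(* The identity map is a homeomorphism. By compactness d1 and d2 are uniformly
   equivalent, so the rho-balls of either pseudometric around a class contain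
   balls of the other around the same class. The rho-open sets are described by
   balls with arbitrary centres, and recentring them needs the triangle
   inequality for rho, which in fact holds in ultrametric form: if mu(c, a') and
   mu(a, b) are small with a, a' homotopic, then c a'^-1 a ~ c and
   a' a'^-1 b ~ b are uniformly close, because the concatenations differ by
   (c, a'), (a', a') and (a, b) on the three thirds of the cube. *)

Require Import Defs.
From HB Require Import structures.
From mathcomp Require Import all_boot all_order all_algebra.
From mathcomp Require Import all_classical all_reals all_analysis.
From mathcomp Require Import lra.
Set Implicit Arguments.
Unset Strict Implicit.
Import Order.TTheory GRing.Theory Num.Theory.
Import numFieldNormedType.Exports.
Local Open Scope classical_set_scope.
Local Open Scope ring_scope.

(** * Continuity: restriction to a subset, pasting, row vectors *)

Lemma continuous_comp_within (Y Z W : topologicalType) (D : set Z) (f : Z -> W)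
    (c : Y -> Z) :
  {within D, continuous f} -> continuous c -> (forall y, D (c y)) ->
  continuous (f \o c).
Proof.
move=> /subspace_continuousP cf cc Dc y V /(cf _ (Dc y)) fV.
change (nbhs y ((f \o c) @^-1` V)); have : nbhs y [set z | D (c z) -> V (f (c z))] := cc y _ fV.
by apply: filterS => z; apply.
Qed.

Lemma continuous_pair (Y Z W : topologicalType) (f : Y -> Z) (g : Y -> W) :
  continuous f -> continuous g -> continuous (fun y => (f y, g y)).
Proof. by move=> cf cg y; exact: cvg_pair (cf y) (cg y). Qed.

Lemma continuousT_comp (Y Z W : topologicalType) (f : Y -> Z) (g : Z -> W) :
  continuous f -> continuous g -> continuous (fun y => g (f y)).
Proof. by move=> cf cg y; exact: continuous_comp (cf y) (cg (f y)). Qed.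

(** Pasting: where [h] and [k] differ, the strict inequality persists nearby and selects one branch;
    where they agree, both branches tend to the same value. *)
Lemma continuous_if_le (R : realType) (Y Z : topologicalType) (f g : Y -> Z)
    (h k : Y -> R) :
  continuous f -> continuous g -> continuous h -> continuous k ->
  (forall y, h y = k y -> f y = g y) ->
  continuous (fun y => if h y <= k y then f y else g y).
Proof.
move=> cf cg ch ck fg y V VV.
change (nbhs y ((fun y => if h y <= k y then f y else g y) @^-1` V)).
have chk : (h \- k) x @[x --> y] --> (h \- k) y by apply: cvgB; [exact: ch|exact: ck].
move: VV; case: (ltgtP (h y) (k y)) => [hk|hk|hk] VV.
- have hk0 : (h \- k) y < 0 by rewrite /= subr_lt0.
  have : nbhs y [set x | h x - k x < 0] := chk _ (lt_nbhsl hk0); have : nbhs y (f @^-1` V) := cf y V VV.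
  apply: filterS2 => x Vx /=; rewrite subr_lt0 => /ltW hkx.
  by rewrite hkx.
- have hk0 : 0 < (h \- k) y by rewrite /= subr_gt0.
  have : nbhs y [set x | 0 < h x - k x] := chk _ (lt_nbhsr hk0); have : nbhs y (g @^-1` V) := cg y V VV.
  apply: filterS2 => x Vx /=; rewrite subr_gt0 => hkx.
  by rewrite leNgt hkx.
- have Vg : nbhs (g y) V by rewrite -fg.
  have : nbhs y (f @^-1` V) := cf y V VV; have : nbhs y (g @^-1` V) := cg y V Vg.
  by apply: filterS2 => x ? ? /=; case: ifP.
Qed.

Lemma continuous_row (R : realType) (Y : topologicalType) n (f : 'I_n -> Y -> R) :
  (forall j, continuous (f j)) -> continuous (fun y => \row_j f j y).
Proof.
move=> cf y V [P /= PP PV].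
have : \forall x \near y, forall i j, P i j ((\row_j f j x) i j).
  apply: filter_forall => i; apply: filter_forall => j.
  have := PP i j; rewrite mxE => /(cf j y) Pf.
  have {}Pf : nbhs y (f j @^-1` P i j) := Pf.
  move: Pf.
  by apply: filterS => x /=; rewrite mxE.
by apply: filterS => x Px; apply: PV.
Qed.

(** * Retraction of the space of row vectors onto the cube *)

Section Clamp.
Variable R : realType.

Definition clamp (x : R) : R := Num.max 0 (Num.min x 1).

Lemma clamp_itv x : 0 <= clamp x <= 1.
Proof. rewrite /clamp /Num.max /Num.min; do !case: ifP; lra. Qed.

Lemma clamp_id x : 0 <= x <= 1 -> clamp x = x.
Proof. rewrite /clamp /Num.max /Num.min; do !case: ifP; lra. Qed.

Lemma clamp_le0 x : x <= 0 -> clamp x = 0.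
Proof. rewrite /clamp /Num.max /Num.min; do !case: ifP; lra. Qed.

Lemma clamp_ge1 x : 1 <= x -> clamp x = 1.
Proof. rewrite /clamp /Num.max /Num.min; do !case: ifP; lra. Qed.

Lemma clamp_continuous : continuous clamp.
Proof.
move=> x.
apply: (@continuous_max R R (fun=> 0) (fun x => Num.min x 1)); first exact: cvg_cst.
by apply: (@continuous_min R R id (fun=> 1)); [exact: cvg_id|exact: cvg_cst].
Qed.

Variable n : nat.
Implicit Types (t : 'rV[R]_n) (i j : 'I_n).

Definition clamp_cube t : 'rV[R]_n := \row_j clamp (t ord0 j).

Lemma clamp_cubeP t : cube R n (clamp_cube t).
Proof. by move=> i; rewrite mxE clamp_itv. Qed.

Lemma clamp_cube_id t : cube R n t -> clamp_cube t = t.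
Proof. by move=> ct; apply/rowP => i; rewrite mxE clamp_id. Qed.

Lemma clamp_cube_continuous : continuous clamp_cube.
Proof.
apply: continuous_row => j.
by move=> t; apply: continuous_comp; [exact: coord_continuous|exact: clamp_continuous].
Qed.

(** The complement of the open cube, boundary included: exactly the points that [clamp_cube] sends
    to the boundary. *)
Definition outside t := exists j, t ord0 j <= 0 \/ 1 <= t ord0 j.

Lemma boundary_outside t : cube_boundary R n t -> outside t.
Proof. by move=> [_ [j [tj|tj]]]; exists j; rewrite tj; [left|right]. Qed.

Lemma outsideNcube t : ~ cube R n t -> outside t.
Proof.
move=> /existsNP[j /negP]; rewrite negb_and -!ltNge => /orP[|] /ltW tj.
  by exists j; left.
by exists j; right.
Qed.

Lemma outside_clamp t : outside t -> cube_boundary R n (clamp_cube t).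
Proof.
move=> [j tj]; split; first exact: clamp_cubeP.
exists j; rewrite mxE; case: tj => tj.
  by left; rewrite clamp_le0.
by right; rewrite clamp_ge1.
Qed.

Definition upd i t (v : R) : 'rV[R]_n := \row_j if j == i then v else t ord0 j.

Lemma upd_id i t : upd i t (t ord0 i) = t.
Proof. by apply/rowP => j; rewrite mxE; case: eqP => // ->. Qed.

Lemma updE i t v : upd i t v ord0 i = v.
Proof. by rewrite mxE eqxx. Qed.

Lemma upd_upd i t v w : upd i (upd i t v) w = upd i t w.
Proof. by apply/rowP => j; rewrite !mxE; case: eqP. Qed.

Lemma upd_continuous (Y : topologicalType) i (f : Y -> 'rV[R]_n) (v : Y -> R) :
  continuous f -> continuous v -> continuous (fun y => upd i (f y) (v y)).
Proof.
move=> cf cv; apply: continuous_row => j.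
case: eqP => _ //.
move=> y; apply: (@continuous_comp _ _ _ f (fun t => t ord0 j)); first exact: cf.
exact: coord_continuous.
Qed.

Lemma outside_upd i t v :
  outside t -> (t ord0 i <= 0 \/ 1 <= t ord0 i -> v <= 0 \/ 1 <= v) ->
  outside (upd i t v).
Proof.
move=> [j tj] tv; exists j; rewrite mxE; case: eqP => // ji.
by apply: tv; rewrite -ji.
Qed.

End Clamp.

(** * Homotopy relative to the boundary is an equivalence relation on loops *)

Section Homotopy.
Variables (R : realType) (T : topologicalType) (n : nat) (x0 : T).
Implicit Types (a b c : 'rV[R]_n -> T) (t : 'rV[R]_n) (i : 'I_n).

Local Notation cube := (cube R n).
Local Notation Omega := (Omega R T n x0).
Local Notation homotopic := (homotopic_rel R T n x0).
Local Notation ext a := (a \o @clamp_cube R n).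

Lemma ext_continuous a : Omega a -> continuous (ext a).
Proof.
move=> [ca _]; apply: continuous_comp_within ca _ _.
  exact: clamp_cube_continuous.
exact: clamp_cubeP.
Qed.

Lemma ext_outside a t : Omega a -> outside t -> ext a t = x0.
Proof. by move=> [_ ax0] /outside_clamp /ax0. Qed.

Lemma ext_cube a t : cube t -> ext a t = a t.
Proof. by move=> /clamp_cube_id /= ->. Qed.

(* Clamping both the time and the cube variable makes a homotopy globally
   continuous, and equal to the base point off the open cube. *)
Lemma homotopic_global a b : homotopic a b ->
  exists H : R * 'rV[R]_n -> T,
    [/\ continuous H,
        forall t, cube t -> H (0, t) = a t,
        forall t, cube t -> H (1, t) = b t &
        forall s t, outside t -> H (s, t) = x0].
Proof.
move=> [H [cH H0 H1 Hx0]].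
exists (H \o (fun p => (clamp p.1, clamp_cube p.2))); split => /=.
- apply: continuous_comp_within cH _ _; last first.
    by move=> p; split => /=; [rewrite in_itv /=; exact: clamp_itv|exact: clamp_cubeP].
  apply: continuous_pair.
    by apply: continuousT_comp (@clamp_continuous R) => p; exact: cvg_fst.
  by apply: continuousT_comp (@clamp_cube_continuous R n) => p; exact: cvg_snd.
- by move=> t ct; rewrite clamp_cube_id // clamp_le0 // H0.
- by move=> t ct; rewrite clamp_cube_id // clamp_ge1 // H1.
- by move=> s t ot; apply: Hx0; [exact: clamp_itv|exact: outside_clamp].
Qed.

Lemma homotopic_of_global a b (H : R * 'rV[R]_n -> T) :
  continuous H -> (forall t, cube t -> H (0, t) = a t) ->
  (forall t, cube t -> H (1, t) = b t) ->
  (forall s t, outside t -> H (s, t) = x0) -> homotopic a b.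
Proof.
move=> cH H0 H1 Hx0; exists H; split => //.
  exact: continuous_subspaceT.
by move=> s t _ /boundary_outside; exact: Hx0.
Qed.

Lemma homotopic_sym a b : homotopic a b -> homotopic b a.
Proof.
move=> /homotopic_global[H [cH H0 H1 Hx0]].
apply: (@homotopic_of_global _ _ (H \o (fun p => (1 - p.1, p.2)))) => /=.
- apply: continuousT_comp cH; apply: continuous_pair => p; last exact: cvg_snd.
  by apply: cvgB; [exact: cvg_cst|exact: cvg_fst].
- by move=> t ct; rewrite subr0 H1.
- by move=> t ct; rewrite subrr H0.
- by move=> s t /Hx0.
Qed.

Lemma homotopic_trans b a c : homotopic a b -> homotopic b c -> homotopic a c.
Proof.
move=> /homotopic_global[H [cH H0 H1 Hx0]] /homotopic_global[K [cK K0 K1 Kx0]].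
have cscale l : continuous (fun p : R * 'rV[R]_n => (2 * p.1 + l, p.2)).
  apply: continuous_pair => p; last exact: cvg_snd.
  by apply: cvgD; [apply: cvgM; [exact: cvg_cst|exact: cvg_fst]|exact: cvg_cst].
apply: (@homotopic_of_global _ _ (fun p : R * 'rV[R]_n =>
  if p.1 <= 2^-1 then H (2 * p.1 + 0, p.2) else K (2 * p.1 + -1, p.2))) => /=.
- apply: continuous_if_le.
  + exact: continuousT_comp (cscale 0) cH.
  + exact: continuousT_comp (cscale (-1)) cK.
  + by move=> p; exact: cvg_fst.
  + by move=> p; exact: cvg_cst.
  + move=> [s t] /= ->; rewrite mulfV // addr0 subrr.
    (* At time 1/2 the two homotopies meet in [b] on the cube only; off the cube both are at the
       base point. *)
    have [ct|/outsideNcube ot] := pselect (cube t); first by rewrite H1 ?K0.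
    by rewrite Hx0 ?Kx0.
- by move=> t ct; rewrite mulr0 addr0 invr_ge0 ler0n H0.
- move=> t ct; rewrite ifN; first by rewrite (_ : 2 * 1 - 1 = 1) ?K1 //; lra.
  by rewrite -ltNge invf_lt1 ?ltr1n.
- by move=> s t ot; rewrite Hx0 ?Kx0 // if_same.
Qed.

Lemma homotopic_Omega a b : homotopic a b -> Omega b.
Proof.
move=> /homotopic_global[H [cH _ H1 Hx0]]; split; last first.
  by move=> t bt; rewrite -H1; [exact/Hx0/boundary_outside|case: bt].
have cH1 : {within cube, continuous (fun t => H (1, t))}.
  apply: continuous_subspaceT.
  by apply: continuousT_comp cH; apply: continuous_pair; [exact: cst_continuous|move=> t; exact: cvg_id].
apply: subspace_eq_continuous cH1 => t /set_mem; exact: H1.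
Qed.

Lemma homotopic_refl a : Omega a -> homotopic a a.
Proof.
move=> aO; apply: (@homotopic_of_global _ _ (ext a \o snd)) => /=.
- by apply: continuousT_comp (ext_continuous aO) => p; exact: cvg_snd.
- exact: ext_cube.
- exact: ext_cube.
- by move=> _ t; exact: ext_outside.
Qed.

(** Maps are total functions on row vectors, and only their values on the cube count. This allows
    passing between a map and its clamped extension. *)
Lemma homotopic_eq a a' b b' : (forall t, cube t -> a t = a' t) ->
  (forall t, cube t -> b t = b' t) -> homotopic a b -> homotopic a' b'.
Proof.
move=> aa' bb' [H [cH H0 H1 Hx0]]; exists H; split => // t ct.
  by rewrite H0 ?aa'.
by rewrite H1 ?bb'.
Qed.

(** * Reparametrization and threefold concatenation along one coordinate *)

Lemma coord_fun_continuous i : continuous (fun t => t ord0 i).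
Proof. by move=> t; exact: coord_continuous. Qed.

(** The straight-line homotopy from [psi] to the identity fixes 0 and 1. Since [psi] may leave the
    unit interval in between, [F] is continuous on the whole space and is at the base point on the
    full hyperplanes where a coordinate is 0 or 1. *)
Lemma homotopic_reparam i (F : 'rV[R]_n -> T) (psi : R -> R) :
  continuous F -> continuous psi -> psi 0 = 0 -> psi 1 = 1 ->
  (forall t j, t ord0 j = 0 \/ t ord0 j = 1 -> F t = x0) ->
  homotopic (fun t => F (upd i t (psi (t ord0 i)))) F.
Proof.
move=> cF cpsi psi0 psi1 Fx0.
exists (fun p => F (upd i p.2 ((1 - p.1) * psi (p.2 ord0 i) + p.1 * p.2 ord0 i))).
split => /=.
- apply: continuous_subspaceT; apply: continuousT_comp cF.
  have c2 : continuous (fun p : R * 'rV[R]_n => p.2) by move=> p; exact: cvg_snd.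
  have c1 : continuous (fun p : R * 'rV[R]_n => p.1) by move=> p; exact: cvg_fst.
  have ci := continuousT_comp c2 (@coord_fun_continuous i).
  apply: upd_continuous => // p; apply: cvgD; apply: cvgM.
  + by apply: cvgB; [exact: cvg_cst|exact: c1].
  + exact: (continuousT_comp ci cpsi).
  + exact: c1.
  + exact: ci.
- by move=> t ct; rewrite subr0 mul1r mul0r addr0.
- by move=> t ct; rewrite subrr mul0r mul1r add0r upd_id.
- move=> s t _ [ct [j tj]]; apply: (Fx0 _ j); rewrite mxE; case: eqP => // ji.
  rewrite -ji; case: tj => ->.
    by left; rewrite psi0 !mulr0 addr0.
  by right; rewrite psi1 !mulr1 subrK.
Qed.

(* [a b^-1 c], concatenated along the coordinate [i]. *)
Definition concat3 i a b c t : T :=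
  let s := t ord0 i in
  if 3 * s <= 1 then a (upd i t (3 * s))
  else if 3 * s <= 2 then b (upd i t (2 - 3 * s))
  else c (upd i t (3 * s - 2)).

Lemma concat3_outside i a b c t :
  (forall t, outside t -> a t = x0) -> (forall t, outside t -> b t = x0) ->
  (forall t, outside t -> c t = x0) -> outside t -> concat3 i a b c t = x0.
Proof.
move=> ax0 bx0 cx0 ot; rewrite /concat3.
case: (leP (3 * _) 1) => s1; [apply: ax0|case: (leP (3 * _) 2) => s2; [apply: bx0|apply: cx0]];
  by apply: outside_upd ot _ => -[ti|ti]; [left|right]; lra.
Qed.

(** The parameter space [Y] will be the time axis of a homotopy. At the seams, where three times the
    coordinate is 1 or 2, adjacent pieces are evaluated at an endpoint of coordinate [i], hence both
    give the base point. *)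
Lemma concat3_continuous (Y : topologicalType) i (A B C : Y * 'rV[R]_n -> T) :
  continuous A -> continuous B -> continuous C ->
  (forall y t, outside t -> A (y, t) = x0) ->
  (forall y t, outside t -> B (y, t) = x0) ->
  (forall y t, outside t -> C (y, t) = x0) ->
  continuous (fun p => concat3 i (fun t => A (p.1, t)) (fun t => B (p.1, t))
                                 (fun t => C (p.1, t)) p.2).
Proof.
move=> cA cB cC Ax0 Bx0 Cx0; rewrite /concat3 /=.
have c2 : continuous (fun p : Y * 'rV[R]_n => p.2) by move=> p; exact: cvg_snd.
have c1 : continuous (fun p : Y * 'rV[R]_n => p.1) by move=> p; exact: cvg_fst.
have ci := continuousT_comp c2 (@coord_fun_continuous i).
have c3 : continuous (fun p : Y * 'rV[R]_n => 3 * p.2 ord0 i).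
  by move=> p; apply: cvgM; [exact: cvg_cst|exact: ci].
have cupd (v : Y * 'rV[R]_n -> R) :
    continuous v -> continuous (fun p => (p.1, upd i p.2 (v p))).
  by move=> cv; apply: continuous_pair => //; exact: upd_continuous.
have oupd t v : v <= 0 \/ 1 <= v -> outside (upd i t v).
  by move=> v01; exists i; rewrite updE.
apply: continuous_if_le => //.
- exact: continuousT_comp (cupd _ c3) cA.
- apply: continuous_if_le => //.
  + apply: continuousT_comp cB; apply: cupd => p.
    by apply: cvgB; [exact: cvg_cst|exact: c3].
  + apply: continuousT_comp cC; apply: cupd => p.
    by apply: cvgB; [exact: c3|exact: cvg_cst].
  + exact: cst_continuous.
  + by move=> p ->; rewrite Bx0 ?Cx0 //; apply: oupd; left; lra.
- exact: cst_continuous.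
- move=> p ->; rewrite ifT; last by lra.
  by rewrite Ax0 ?Bx0 //; apply: oupd; right; lra.
Qed.

(** Running the homotopy in the last third alone, with the other two thirds held fixed, suffices. *)
Lemma concat3_homotopic i a b c c' : Omega a -> Omega b -> homotopic c c' ->
  homotopic (concat3 i (ext a) (ext b) (ext c)) (concat3 i (ext a) (ext b) (ext c')).
Proof.
move=> aO bO /homotopic_global[H [cH H0 H1 Hx0]].
have csnd (f : 'rV[R]_n -> T) : continuous f -> continuous (fun p : R * 'rV[R]_n => f p.2).
  by apply: continuousT_comp => p; exact: cvg_snd.
have cl t : outside t -> outside (clamp_cube t).
  by move=> /outside_clamp /boundary_outside.
apply: (@homotopic_of_global _ _ (fun p : R * 'rV[R]_n =>
  concat3 i (ext a) (ext b) (fun t => H (p.1, clamp_cube t)) p.2)) => /=.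
- apply: (@concat3_continuous _ i (fun p => ext a p.2) (fun p => ext b p.2)
    (fun p => H (p.1, clamp_cube p.2))).
  + exact: csnd (ext_continuous aO).
  + exact: csnd (ext_continuous bO).
  + apply: continuousT_comp cH; apply: continuous_pair => [p|]; first exact: cvg_fst.
    by apply: continuousT_comp (@clamp_cube_continuous R n) => p; exact: cvg_snd.
  + by move=> s t; exact: ext_outside.
  + by move=> s t; exact: ext_outside.
  + by move=> s t /cl; exact: Hx0.
- by move=> t _; congr concat3; apply/funext => u /=; rewrite H0 //; exact: clamp_cubeP.
- by move=> t _; congr concat3; apply/funext => u /=; rewrite H1 //; exact: clamp_cubeP.
- move=> s t; apply: concat3_outside => u.
  + exact: ext_outside.
  + exact: ext_outside.
  + by move=> /cl; exact: Hx0.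
Qed.

(* [a b^-1 b] traverses [a b^-1] along the path 0 -> 2 -> 1, which is
   straightened to 0 -> 1. *)
Lemma concat3_cancelr i a b : Omega a -> Omega b ->
  homotopic (concat3 i (ext a) (ext b) (ext b)) a.
Proof.
move=> aO bO.
(* [F] is [a] on [0, 1] followed by [b] reversed on [1, 2], at unit speed; [psi] climbs to 2 at s =
   2/3, then descends to 1. *)
pose F t := if t ord0 i <= 1 then ext a t else ext b (upd i t (2 - t ord0 i)).
pose psi (s : R) := Num.min (3 * s) (4 - 3 * s).
have ci := @coord_fun_continuous i.
have oi (v : R) t : v <= 0 \/ 1 <= v -> outside (upd i t v).
  by move=> v01; exists i; rewrite updE.
have cpsi : continuous psi.
  have c3 : continuous (fun s : R => 3 * s).
    by move=> u; apply: cvgM; [exact: cvg_cst|exact: cvg_id].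
  move=> s; apply: (@continuous_min R R (fun s => 3 * s) (fun s => 4 - 3 * s)).
    exact: c3.
  by apply: cvgB; [exact: cvg_cst|exact: c3].
have cv : continuous (fun t : 'rV[R]_n => 2 - t ord0 i).
  apply: (@continuousT_comp _ _ _ _ (fun x : R => 2 - x) ci) => x.
  by apply: cvgB; [exact: cvg_cst|exact: cvg_id].
have cF : continuous F.
  apply: continuous_if_le => //.
  - exact: ext_continuous.
  - apply: continuousT_comp (ext_continuous bO).
    by apply: upd_continuous => // t; exact: cvg_id.
  - exact: cst_continuous.
  - move=> t ti; rewrite !ext_outside //; last by exists i; right; rewrite ti.
    by apply: oi; right; rewrite ti; lra.
have Fx0 t j : t ord0 j = 0 \/ t ord0 j = 1 -> F t = x0.
  move=> tj; rewrite /F; case: ifPn => ti; apply: ext_outside => //; exists j.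
    by case: tj => ->; [left|right].
  rewrite mxE; case: eqP => [ji|_]; last by case: tj => ->; [left|right].
  by move: ti; rewrite -ji; case: tj => ->; rewrite ?ler01 ?lexx.
have psi0 : psi 0 = 0 by rewrite /psi mulr0 subr0 min_l.
have psi1 : psi 1 = 1 by rewrite /psi mulr1 min_r; lra.
apply: homotopic_eq (homotopic_reparam i cF cpsi psi0 psi1 Fx0) => t ct.
  have /andP[t0 t1] := ct i.
  rewrite /F updE /concat3 upd_upd /psi; case: (leP (3 * _) (4 - _)) => s1.
    case: ifP => // s2; rewrite ifT //; lra.
  rewrite [in RHS]ifF; last by apply/negbTE; rewrite -ltNge; lra.
  case: (leP (3 * t ord0 i) 2) => s2; first by exfalso; lra.
  (* Here [psi] has value at most 1 on its descent, which in the cube happens only at the end s = 1,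
     where both sides are at the base point. *)
  case: ifP => s3.
    have -> : t ord0 i = 1 by lra.
    by rewrite !ext_outside //; apply: oi; right; lra.
  by congr (ext b (upd _ _ _)); lra.
by rewrite /F ifT ?ext_cube //; case/andP: (ct i).
Qed.

(* [b b^-1 c] traverses [b^-1 c] along the path 0 -> -1 -> 1. *)
Lemma concat3_cancell i b c : Omega b -> Omega c ->
  homotopic (concat3 i (ext b) (ext b) (ext c)) c.
Proof.
move=> bO cO.
(* [F] is [b] reversed on [-1, 0] followed by [c] on [0, 1]; [psi] descends to -1 at s = 1/3, then
   climbs to 1. *)
pose F t := if t ord0 i <= 0 then ext b (upd i t (- t ord0 i)) else ext c t.
pose psi (s : R) := Num.max (- (3 * s)) (3 * s - 2).
have ci := @coord_fun_continuous i.
have oi (v : R) t : v <= 0 \/ 1 <= v -> outside (upd i t v).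
  by move=> v01; exists i; rewrite updE.
have cpsi : continuous psi.
  have c3 : continuous (fun s : R => 3 * s).
    by move=> u; apply: cvgM; [exact: cvg_cst|exact: cvg_id].
  move=> s; apply: (@continuous_max R R (fun s => - (3 * s)) (fun s => 3 * s - 2)).
    by apply: cvgN; exact: c3.
  by apply: cvgB; [exact: c3|exact: cvg_cst].
have cv : continuous (fun t : 'rV[R]_n => - t ord0 i).
  by apply: (@continuousT_comp _ _ _ _ (fun x : R => - x) ci) => x; apply: cvgN; exact: cvg_id.
have cF : continuous F.
  apply: continuous_if_le => //.
  - apply: continuousT_comp (ext_continuous bO).
    by apply: upd_continuous => // t; exact: cvg_id.
  - exact: ext_continuous.
  - exact: cst_continuous.
  - move=> t ti; rewrite !ext_outside //; first by exists i; left; rewrite ti.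
    by apply: oi; left; rewrite ti oppr0.
have Fx0 t j : t ord0 j = 0 \/ t ord0 j = 1 -> F t = x0.
  move=> tj; rewrite /F; case: ifPn => ti; apply: ext_outside => //; exists j.
    rewrite mxE; case: eqP => [ji|_]; last by case: tj => ->; [left|right].
    by move: ti; rewrite -ji; case: tj => ->; [rewrite oppr0; left|lra].
  by case: tj => ->; [left|right].
have psi0 : psi 0 = 0 by rewrite /psi mulr0 oppr0 max_l; lra.
have psi1 : psi 1 = 1 by rewrite /psi mulr1 max_r; lra.
apply: homotopic_eq (homotopic_reparam i cF cpsi psi0 psi1 Fx0) => t ct.
  have /andP[t0 t1] := ct i.
  rewrite /F updE /concat3 upd_upd /psi; case: (leP (3 * t ord0 i) 1) => s1.
    rewrite max_l; last by lra.
    by rewrite ifT ?opprK //; lra.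
  rewrite max_r; last by lra.
  case: (leP (3 * t ord0 i) 2) => s2; first by rewrite ifT ?opprB //; lra.
  by rewrite ifF //; apply/negbTE; rewrite -ltNge; lra.
(* On the cube [F] is [c], except that the face at coordinate 0 falls under the first branch; there
   both branches give the base point. *)
rewrite /F; case: ifP => ti; last by rewrite ext_cube.
have ti0 : t ord0 i = 0 by apply/eqP; rewrite eq_le ti; case/andP: (ct i).
rewrite -(ext_cube c ct) ti0 oppr0 !ext_outside //; first by exists i; left; rewrite ti0.
by apply: oi; left.
Qed.

End Homotopy.

(** * Metrics on a compact space: boundedness and uniform equivalence *)

Section Metric.
Variables (R : realType) (T : topologicalType).
Implicit Types d : T -> T -> R.

Lemma metric_nbhs d x (e : R) : metric_of_T R T d -> 0 < e ->
  nbhs x [set y | d x y < e].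
Proof.
move=> [[_ d0 _ dtri] dtop] e0; apply: open_nbhs_nbhs; split; last first.
  by rewrite /= (d0 x x).2.
apply/dtop => y /= xy; exists (e - d x y); first by rewrite subr_gt0.
by move=> z /=; rewrite ltrBrDl; apply: le_lt_trans.
Qed.

(** Guarantees that the supremum in [mu] is a genuine one. Distances to a fixed [z] are locally
    bounded, by compactness globally bounded by some [M], and any two points are then within [M + M]
    through [z]. *)
Lemma compact_metric_bounded d : compact [set: T] -> metric_of_T R T d ->
  exists M, forall x y, d x y <= M.
Proof.
move=> /compact_near_coveringP cT dT; have [[_ _ dsym dtri] _] := dT.
(* An empty space has no [z] to serve as centre; any bound works there. *)
have [[z]|T0] := pselect (exists z : T, True); last by exists 0 => x; case: T0; exists x.
have nearM : \forall M \near +oo, [set: T] `<=` (fun x => d z x <= M).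
  apply: (cT _ _ (fun (M : R) x => d z x <= M)) => x _.
  exists ([set y | d x y < 1], [set M | d z x + 1 < M]) => /=.
    by split; [exact: metric_nbhs|by apply: nbhs_pinfty_gt; exact: num_real].
  by move=> [y M] /= [xy zM]; have := dtri z x y; lra.
near (pinfty_nbhs R) => M.
have dM x : d z x <= M.
  by have /(_ x I) : [set: T] `<=` (fun x => d z x <= M) by near: M.
exists (M + M) => x y.
by have := dtri x z y; have := dM x; have := dM y; rewrite (dsym x z); lra.
Unshelve. all: by end_near.
Qed.

(** Around each [x] some [d1]-ball of radius [r] lies in the [d2]-ball of radius [e / 2]. If [x'] is
    within [r / 2] of [x] and [delta] is below [r / 2], then [x'] and [y] both lie in that ball.
    Compactness makes one [delta] serve all points. *)
Lemma compact_metric_unif d1 d2 (e : R) : compact [set: T] ->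
  metric_of_T R T d1 -> metric_of_T R T d2 -> 0 < e ->
  exists2 delta : R, 0 < delta & forall x y, d1 x y < delta -> d2 x y < e.
Proof.
move=> /compact_near_coveringP cT d1T d2T e0.
have [[_ _ d1sym d1tri] top1] := d1T; have [[_ _ d2sym d2tri] top2] := d2T.
have e2 : 0 < e / 2 by rewrite divr_gt0.
have near_delta : \forall delta \near 0^'+,
    [set: T] `<=` (fun x => forall y, d1 x y < delta -> d2 x y < e).
  apply: (cT _ _ (fun (delta : R) x => forall y, d1 x y < delta -> d2 x y < e)).
  move=> x _.
  have : nbhs x [set y | d2 x y < e / 2] by exact: metric_nbhs.
  rewrite nbhsE => -[A [oA Ax] Asub].
  have [r r0 rA] := (top1 A).1 oA x Ax.
  have r2 : 0 < r / 2 by rewrite divr_gt0.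
  exists ([set y | d1 x y < r / 2], [set delta | delta < r / 2]) => /=.
    by split; [exact: metric_nbhs|exact: nbhs_right_lt].
  move=> [x' delta] /= [xx' dr] y x'y.
  have A1 : d2 x x' < e / 2 by apply/Asub/rA => /=; lra.
  have A2 : d2 x y < e / 2.
    by apply/Asub/rA => /=; have := d1tri x x' y; lra.
  by have := d2tri x' x y; rewrite (d2sym x' x); lra.
near (0 : R)^'+ => delta.
exists delta => // x y.
by have /(_ x I y) : [set: T] `<=` (fun x => forall y, d1 x y < delta -> d2 x y < e) by near: delta.
Unshelve. all: by end_near.
Qed.

Lemma mu_ge d n (a b : 'rV[R]_n -> T) t : compact [set: T] ->
  metric_of_T R T d -> cube R n t -> d (a t) (b t) <= mu R T d n a b.
Proof.
move=> cT dT ct; have [M dM] := compact_metric_bounded cT dT.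
apply: ub_le_sup; last by exists t.
by exists M => _ [u _ <-].
Qed.

Lemma mu_le d n (a b : 'rV[R]_n -> T) (r : R) :
  (forall t, cube R n t -> d (a t) (b t) <= r) -> mu R T d n a b <= r.
Proof.
move=> dr; apply: ge_sup.
  (* The least-upper-bound property needs a nonempty set; the origin lies in the cube. *)
  by exists (d (a 0) (b 0)), 0 => // i; rewrite mxE lexx ler01.
by move=> _ [t ct <-]; exact: dr.
Qed.

Lemma mu_ge0 d n (a b : 'rV[R]_n -> T) : compact [set: T] ->
  metric_of_T R T d -> 0 <= mu R T d n a b.
Proof.
move=> cT dT; have [[d_ge0 _ _ _] _] := dT.
apply: le_trans (d_ge0 (a 0) (b 0)) (mu_ge _ _ _ _ _) => //.
by move=> i; rewrite mxE lexx ler01.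
Qed.

(** * The pseudometric [rho] on homotopy classes *)

Variables (n : nat) (x0 : T).
Local Notation pi_n := (pi_n R T n x0).
Implicit Types A B C : pi_n.

Lemma pi_n_rep A : exists a, sval A a.
Proof.
have [a aO eA] := svalP A; exists a; rewrite eA; split => //.
exact: homotopic_refl.
Qed.

Lemma pi_n_Omega A a : sval A a -> Omega R T n x0 a.
Proof. by have [a0 _ ->] := svalP A => -[]. Qed.

Lemma pi_n_homotopic A a b : sval A a -> sval A b -> homotopic_rel R T n x0 a b.
Proof.
have [a0 _ ->] := svalP A => -[_ h] [_ k].
exact: homotopic_trans (homotopic_sym h) k.
Qed.

Lemma pi_n_closed A a b : sval A a -> homotopic_rel R T n x0 a b -> sval A b.
Proof.
have [a0 _ ->] := svalP A => -[_ h] ab; split; first exact: homotopic_Omega ab.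
exact: homotopic_trans h ab.
Qed.

Lemma rho_le d A B a b : compact [set: T] -> metric_of_T R T d ->
  sval A a -> sval B b -> rho R T d n x0 A B <= mu R T d n a b.
Proof.
move=> cT dT Aa Bb; apply: ge_inf; last by exists a => //; exists b.
by exists 0 => _ [a' _ [b' _ <-]]; exact: mu_ge0.
Qed.

Lemma rho_lt d A B (r : R) : rho R T d n x0 A B < r ->
  exists a b, [/\ sval A a, sval B b & mu R T d n a b < r].
Proof.
move=> /inf_lt[].
  have [a Aa] := pi_n_rep A; have [b Bb] := pi_n_rep B.
  by exists (mu R T d n a b), a => //; exists b.
by move=> _ [a Aa [b Bb <-]] ab; exists a, b.
Qed.

Lemma rho_ultrametric d A B C (r : R) : (0 < n)%N -> compact [set: T] ->
  metric_of_T R T d -> rho R T d n x0 C A < r -> rho R T d n x0 A B < r ->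
  rho R T d n x0 C B < r.
Proof.
move=> n0 cT dT /rho_lt[c [a' [Cc Aa' ca]]] /rho_lt[a [b [Aa Bb ab]]].
have [[d_ge0 d0 _ _] _] := dT.
(* A positive dimension provides a first coordinate along which to concatenate. *)
pose i := Ordinal n0; pose ext (f : 'rV[R]_n -> T) := f \o @clamp_cube R n.
have [cO aO a'O bO] : [/\ Omega R T n x0 c, Omega R T n x0 a, Omega R T n x0 a'
    & Omega R T n x0 b] by split; apply: pi_n_Omega; eassumption.
(* In the class of [c a'^-1 a'], hence of [c], because [a] and [a'] both represent [A]. *)
have Cw : sval C (concat3 i (ext c) (ext a') (ext a)).
  apply: pi_n_closed Cc _; apply: homotopic_trans (homotopic_sym _) _.
    exact: (concat3_cancelr i cO a'O).
  by apply: concat3_homotopic => //; exact: pi_n_homotopic Aa' Aa.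
have Bw : sval B (concat3 i (ext a') (ext a') (ext b)).
  by apply: pi_n_closed Bb _; apply/homotopic_sym/concat3_cancell.
apply: le_lt_trans (rho_le cT dT Cw Bw) _.
apply: (@le_lt_trans _ _ (Num.max (mu R T d n c a') (mu R T d n a b))); last first.
  by rewrite gt_max ca ab.
apply: mu_le => t _; rewrite le_max /concat3 /ext /=.
(* The first third is controlled by [mu c a'] and the last by [mu a b]; in the middle both maps run
   through the same [a'], at distance 0. *)
case: ifP => _; first by rewrite mu_ge //; exact: clamp_cubeP.
case: ifP => _; last by rewrite (mu_ge _ _ cT dT) ?orbT //; exact: clamp_cubeP.
by rewrite (d0 _ _).2 // mu_ge0.
Qed.

Lemma rho_refl d A : metric_of_T R T d -> compact [set: T] ->
  rho R T d n x0 A A <= 0.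
Proof.
move=> dT cT; have [[_ d0 _ _] _] := dT; have [a Aa] := pi_n_rep A.
apply: le_trans (rho_le cT dT Aa Aa) _.
by apply: mu_le => t _; rewrite (d0 _ _).2.
Qed.

(** The given [d2]-ball has centre [C], but the [d1]-ball is built around [A]: a class [d1]-close to
    [A] is [d2]-close to [A], hence to [C] with the same radius by the ultrametric inequality. *)
Lemma rho_open_mono d1 d2 (U : set pi_n) : (0 < n)%N -> compact [set: T] ->
  metric_of_T R T d1 -> metric_of_T R T d2 ->
  rho_open R T d2 n x0 U -> rho_open R T d1 n x0 U.
Proof.
move=> n0 cT d1T d2T oU A UA; have [C [r [CA CU]]] := oU A UA.
have r0 : 0 < r.
  have [c [a [_ _]]] := rho_lt CA; apply: le_lt_trans; exact: mu_ge0.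
(* Pointwise strict bounds give only a weak bound on the supremum [mu]; halving [r] restores
   strictness. *)
have r2 : 0 < r / 2 by rewrite divr_gt0.
have [delta delta0 d12] := compact_metric_unif cT d1T d2T r2.
exists A, delta; split; first exact: le_lt_trans (rho_refl A d1T cT) delta0.
move=> B /= /rho_lt[a [b [Aa Bb ab]]]; apply: CU => /=.
apply: rho_ultrametric CA _ => //.
apply: le_lt_trans (rho_le cT d2T Aa Bb) _.
apply: (@le_lt_trans _ _ (r / 2)); last by lra.
apply: mu_le => t ct; apply/ltW/d12.
exact: le_lt_trans (mu_ge a b cT d1T ct) ab.
Qed.

End Metric.

(** * Independence of the metric *)

Unset Implicit Arguments.

Theorem theorem4p10 (R : realType) (X : topologicalType) (x0 : X) (n : nat)
  (d1 d2 : X -> X -> R) :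
  path_connected R X -> compact [set: X] ->
  metric_of_T R X d1 -> metric_of_T R X d2 -> (0 < n)%N ->
  exists (f : pi_n R X n x0 -> pi_n R X n x0) (g : pi_n R X n x0 -> pi_n R X n x0),
    [/\ cancel f g, cancel g f,
        (forall U, rho_open R X d2 n x0 U -> rho_open R X d1 n x0 (f @^-1` U)) &
        (forall U, rho_open R X d1 n x0 U -> rho_open R X d2 n x0 (g @^-1` U))].
Proof.
(* The two continuity claims are one monotonicity statement with the metrics exchanged. *)
move=> _ cX d1X d2X n0; exists id, id; split => // U; exact: rho_open_mono.
Qed.
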